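(* Let $C_n$ be the cycle on $n$ vertices. For $n\ge3$, the Laplacian simplex $T_{C_n}$ is reflexive if and only if $n$ is odd. For $k\ge2$, the simplex $T_{C_{2k}}$ is $2$-reflexive.
   Context: For a connected simple graph $G$ on vertex set $[n]$, its Laplacian $L$ has $L_{ii}=\deg(i)$, $L_{ij}=-1$ if $\{i,j\}$ is an edge and $0$ otherwise. Let $A$ be the $n\times(n-1)$ matrix with $a_{ij}=1$ if $i\le j\le n-1$ and $0$ otherwise, and $L_B=LA$. The Laplacian simplex $T_G\subseteq\mathbb{R}^{n-1}$ is the convex hull of the rows of $L_B$. A full-dimensional lattice polytope $P$ is reflexive if it contains the origin in its interior and its dual $P^*=\{x: x\cdot y\le1\ \forall y\in P\}$ is a lattice polytope. For a positive integer $\ell$, a lattice polytope $P$ is $\ell$-reflexive if (i) it contains the origin in its interior, (ii) its vertices are primitive (the segment from the origin to each vertex contains no other lattice point), and (iii) for every facet $F$, the integral (lattice) distance from the origin to the affine hyperplane spanned by $F$ equals $\ell$. *)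

(* Defs.v *)
From HB Require Import structures.
From mathcomp Require Import all_boot all_order all_algebra.
From mathcomp Require Import classical_sets reals topology normedtype.

Set Implicit Arguments.
Unset Strict Implicit.
Unset Printing Implicit Defensive.

Import Order.TTheory GRing.Theory Num.Theory.
Import numFieldNormedType.Exports.

Local Open Scope classical_set_scope.
Local Open Scope ring_scope.

Section Polytopes.
Variables (R : realType) (d : nat).
Implicit Types (P F S : set 'rV[R]_d) (u v x y : 'rV[R]_d).

Definition dot x y : R := \sum_j x 0 j * y 0 j.

Definition row_conv (m : nat) (M : 'M[R]_(m, d)) : set 'rV[R]_d :=
  [set x | exists w : 'rV[R]_m,
     [/\ forall i, 0 <= w 0 i, \sum_i w 0 i = 1 & x = w *m M]].

Definition aff_hull S : set 'rV[R]_d :=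
  [set x | exists (m : nat) (M : 'M[R]_(m, d)) (w : 'rV[R]_m),
     [/\ forall i, S (row i M), \sum_i w 0 i = 1 & x = w *m M]].

Definition aff_independent (m : nat) (M : 'M[R]_(m, d)) : Prop :=
  forall w : 'rV[R]_m, \sum_i w 0 i = 0 -> w *m M = 0 -> w = 0.

(* The affine hull of S has dimension k, witnessed by an affine basis taken
   in S; the empty set (dimension -1) satisfies this for no k. *)
Definition has_dim S (k : nat) : Prop :=
  exists M : 'M[R]_(k.+1, d),
    [/\ forall i, S (row i M), aff_independent M
      & S `<=` aff_hull [set x | exists i, x = row i M]].

Definition lattice_point x : Prop := forall j, x 0 j \is a Num.int.

Definition lattice_polytope P : Prop :=
  exists (m : nat) (M : 'M[R]_(m, d)),
    (forall i, lattice_point (row i M)) /\ P = row_conv M.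

Definition polar_dual P : set 'rV[R]_d :=
  [set x | forall y, P y -> dot x y <= 1].

(* P itself (u = 0, c = 0) and the empty set (u = 0, c = 1) are faces. *)
Definition is_face P F : Prop :=
  exists u (c : R), (forall x, P x -> dot u x <= c) /\
    F = [set x | P x /\ dot u x = c].

Definition is_vertex P v : Prop := is_face P [set v].

Definition is_facet P F : Prop :=
  is_face P F /\ exists k : nat, has_dim P k.+1 /\ has_dim F k.

Definition primitive v : Prop :=
  [/\ lattice_point v, v <> 0
    & forall t : R, 0 <= t <= 1 -> lattice_point (t *: v) ->
        t *: v = 0 \/ t *: v = v].

(* The integral distance from the origin to H is l: H has an equation
   u . x = l with u a primitive vector of the dual lattice Z^d. Such a pair
   (u, l) with l >= 0 is unique, up to the sign of u when l = 0. *)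
Definition lattice_distance (H : set 'rV[R]_d) (l : nat) : Prop :=
  exists2 u, primitive u & H = [set x | dot u x = l%:R].

Definition reflexive_polytope P : Prop :=
  [/\ lattice_polytope P, has_dim P d, interior P 0
    & lattice_polytope (polar_dual P)].

Definition ell_reflexive (l : nat) P : Prop :=
  [/\ (0 < l)%N /\ lattice_polytope P, interior P 0,
      forall v, is_vertex P v -> primitive v
    & forall F, is_facet P F -> lattice_distance (aff_hull F) l].

End Polytopes.

(* Vertices 1, ..., n are represented by 0, ..., n - 1. *)
Record connected_sgraph (n : nat) := ConnectedSgraph {
  adj : rel 'I_n;
  adj_sym : symmetric adj;
  adj_irr : irreflexive adj;
  adj_conn : forall i j, connect adj i j }.

Section Laplacian.
Variables (n : nat) (G : connected_sgraph n).

Definition degree (i : 'I_n) : nat := #|[set j | adj G i j]%SET|.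

Definition laplacian : 'M[int]_n :=
  \matrix_(i, j) if i == j then (degree i)%:Z else if adj G i j then -1 else 0.

Definition partial_sum_mx : 'M[int]_(n, n.-1) := \matrix_(i, j) (i <= j)%N%:Z.

Definition laplacianB : 'M[int]_(n, n.-1) := laplacian *m partial_sum_mx.

Definition laplacian_simplex (R : realType) : set 'rV[R]_(n.-1) :=
  row_conv (map_mx intr laplacianB).

End Laplacian.

Arguments laplacian_simplex [n] G R _.

(* The condition i != j only matters for n = 1, where ordS i = i. *)
Definition cycle_adj (n : nat) : rel 'I_n :=
  fun i j => (i != j) && ((j == ordS i) || (i == ordS j)).

Lemma cycle_adj_sym n : symmetric (@cycle_adj n).
Proof. by move=> i j; rewrite /cycle_adj eq_sym orbC. Qed.

Lemma cycle_adj_irr n : irreflexive (@cycle_adj n).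
Proof. by move=> i; rewrite /cycle_adj eqxx. Qed.

Lemma cycle_adj_conn n (i j : 'I_n) : connect (@cycle_adj n) i j.
Proof.
have up k (a b : 'I_n) : b = (a + k)%N :> nat -> connect (@cycle_adj n) a b.
  elim: k b => [|k IHk] b eb.
    by rewrite (_ : b = a) ?connect0 //; apply/val_inj; rewrite /= eb addn0.
  have lt_n : (a + k < n)%N by rewrite (leq_trans _ (ltn_ord b))// eb addnS.
  apply: connect_trans (IHk (Ordinal lt_n) erefl) (connect1 _).
  rewrite /cycle_adj -!val_eqE /= eb addnS neq_ltn ltnSn /=.
  by rewrite modn_small ?eqxx // -addnS -eb.
have [le_ij | /ltnW le_ji] := leqP i j; first by apply: (up (j - i)%N); rewrite subnKC.
rewrite (sym_connect_sym (@cycle_adj_sym n)); apply: (up (i - j)%N).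
by rewrite subnKC.
Qed.

Definition cycle_graph (n : nat) : connected_sgraph n :=
  ConnectedSgraph (@cycle_adj_sym n) (@cycle_adj_irr n) (@cycle_adj_conn n).

(* Main.v *)
(** Let the vertices of a simplex with barycenter at the origin be the rows
[v_i] of [V], and let its facet normals be the rows [u_i] of [U],
normalised so that [u_i . v_j = 1] for [j != i].  Then [x = sum_i w_i v_i] with
[w_i = (1 - u_i . x) / (d + 1)], so the simplex is cut out by the
inequalities [u_i . x <= 1] and its polar dual is the convex hull of the [u_i].  For the cycle on [n] vertices, [v_i = e_i - e_(i-1)] with cyclic
indices, where [e_(n-1) = - (e_0 + ... + e_(n-2))], and
[u_i(b) = ((b - i) mod n) - (n - 1) / 2].  These normals are integral exactly
when [n] is odd; when [n] is even, [2 u_i] is integral and has an entry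
[1] or [-1], hence is primitive, and the facet lies on [2 u_i . x = 2]. *)

Require Import Defs.
From mathcomp Require Import all_boot all_order all_algebra.
From mathcomp Require Import classical_sets reals topology normedtype.
From mathcomp Require Import ring lra zify.

Set Implicit Arguments.
Unset Strict Implicit.
Unset Printing Implicit Defensive.

Import Order.TTheory GRing.Theory Num.Theory.
Import numFieldNormedType.Exports.

Local Open Scope classical_set_scope.
Local Open Scope ring_scope.

(** * Convex hulls, supporting hyperplanes and polars *)

Section Convexity.
Variables (R : realType) (d : nat).
Implicit Types (u x y : 'rV[R]_d) (P F S : set 'rV[R]_d).

Lemma dot_row m (M : 'M[R]_(m, d)) i x : dot (row i M) x = (x *m M^T) 0 i.
Proof. by rewrite mxE; apply: eq_bigr => j _; rewrite !mxE mulrC. Qed.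

Lemma dotC x y : dot x y = dot y x.
Proof. by apply: eq_bigr => j _; rewrite mulrC. Qed.

Lemma dot_mulmx m (M : 'M[R]_(m, d)) u (w : 'rV[R]_m) :
  dot u (w *m M) = \sum_i w 0 i * dot u (row i M).
Proof.
under eq_bigr => i _ do rewrite dotC dot_row.
rewrite dotC -(row_id 0 (w *m M)) dot_row trmx_mul mulmxA mxE.
by apply: eq_bigr => i _; rewrite !mxE mulrC.
Qed.

Lemma dotZl (a : R) u x : dot (a *: u) x = a * dot u x.
Proof. by rewrite mulr_sumr; apply: eq_bigr => j _; rewrite mxE mulrA. Qed.

Lemma sum_delta_row m (i : 'I_m) :
  \sum_j (delta_mx 0 i : 'rV[R]_m) 0 j = 1.
Proof.
rewrite (bigD1 i) //= big1 ?addr0 ?mxE ?eqxx // => j ji.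
by rewrite mxE /= (negPf ji).
Qed.

Lemma sum1_neq0 m (w : 'rV[R]_m) : \sum_i w 0 i = 1 -> exists i, w 0 i != 0.
Proof.
move=> w1; apply/existsP; rewrite -negb_forall; apply/negP => /forallP w0.
suff : \sum_i w 0 i = 0 by rewrite w1 => /eqP; rewrite oner_eq0.
by apply: big1 => i _; apply/eqP/w0.
Qed.

(** If [v_j] is 1 or -1, then [t = (t v_j) v_j] is an integer as soon as [t v] is a lattice point,
    and an integer in [0, 1] is 0 or 1. *)
Lemma primitive_unit_entry (v : 'rV[R]_d) j :
  lattice_point v -> `|v 0 j| = 1 -> primitive v.
Proof.
move=> latv v1; split=> // [v0|t /andP[t0 t1] /(_ j)].
  by move: v1; rewrite v0 mxE normr0 => /eqP; rewrite eq_sym oner_eq0.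
rewrite mxE => tv_int.
have : t \is a Num.int.
  have -> : t = t * v 0 j * v 0 j.
    by rewrite -mulrA -expr2 -real_normK ?num_real // v1 expr1n mulr1.
  by rewrite rpredM.
case/intrP => m tm; move: t0 t1; rewrite tm ler0z lerz1 => m0 m1.
have [->|->] : m = 0 \/ m = 1 by lia.
  by left; rewrite scale0r.
by right; rewrite scale1r.
Qed.

Lemma row_conv_row m (M : 'M[R]_(m, d)) i : row_conv M (row i M).
Proof.
exists (delta_mx 0 i); split; [|exact: sum_delta_row|by rewrite rowE].
by move=> j; rewrite mxE /=; case: eqP.
Qed.

(** The weighted slacks [w_i (c - u . M_i)] are nonnegative and sum to 0, so each of them
    vanishes. *)
Lemma conv_tight m (M : 'M[R]_(m, d)) u (c : R) (w : 'rV[R]_m) :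
  (forall i, 0 <= w 0 i) -> \sum_i w 0 i = 1 ->
  (forall i, dot u (row i M) <= c) -> dot u (w *m M) = c ->
  forall i, w 0 i != 0 -> dot u (row i M) = c.
Proof.
move=> w0 w1 le_c eq_c i wi.
have: \sum_i w 0 i * (c - dot u (row i M)) = 0.
  under eq_bigr => j _ do rewrite mulrBr.
  by rewrite sumrB -mulr_suml w1 mul1r -dot_mulmx eq_c subrr.
have ge0 j : 0 <= w 0 j * (c - dot u (row j M)).
  by rewrite mulr_ge0 ?subr_ge0.
move/(psumr_eq0P (fun j _ => ge0 j))/(_ i isT)/eqP.
by rewrite mulf_eq0 (negPf wi) subr_eq0 => /eqP.
Qed.

Lemma dot_continuous u : continuous (dot u).
Proof.
apply: continuous_big => [|j _ x]; first exact: add_continuous.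
apply: (@continuousM _ _ (fun=> u 0 j)); first exact: cst_continuous.
exact: coord_continuous.
Qed.

Lemma polar_dual_row_conv m (M : 'M[R]_(m, d)) :
  polar_dual (row_conv M) = [set x | forall i, dot (row i M) x <= 1].
Proof.
apply/seteqP; split => x /= Px.
  by move=> i; rewrite dotC; apply/Px/row_conv_row.
move=> _ [w [w0 w1 ->]]; rewrite dot_mulmx -w1; apply: ler_sum => i _.
by rewrite dotC ler_piMr.
Qed.

(** A row of nonzero weight in [x] is tight for the functional that exposes [x], hence lies in the
    face [[set x]]. *)
Lemma vertex_row_conv m (M : 'M[R]_(m, d)) x :
  is_vertex (row_conv M) x -> exists i, x = row i M.
Proof.
move=> [u [c [le_c ex]]].
have [[w [w0 w1 xw]] uxc] : row_conv M x /\ dot u x = c.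
  by have : [set x] x by []; rewrite ex.
have [i wi] := sum1_neq0 w1.
exists i; suff : [set x] (row i M) by [].
rewrite ex; split; first exact: row_conv_row.
apply: conv_tight w0 w1 _ _ i wi; last by rewrite -xw.
by move=> j; apply/le_c/row_conv_row.
Qed.

(** * Affine dimension as the rank of homogenized points *)

(** The leading coordinate 1 turns affine combinations into linear ones, so that a set of dimension
    [k] spans a space of rank [k.+1]. *)
Definition homogenize m (M : 'M[R]_(m, d)) : 'M[R]_(m, 1 + d) :=
  row_mx (const_mx 1) M.

Lemma mul_homogenize m (M : 'M[R]_(m, d)) (w : 'rV[R]_m) :
  w *m homogenize M = row_mx (\sum_i w 0 i)%:M (w *m M).
Proof.
rewrite mul_mx_row; congr row_mx; apply/rowP => j; rewrite !ord1 !mxE eqxx.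
by apply: eq_bigr => i _; rewrite mxE mulr1.
Qed.

Lemma homogenize_affine m (M : 'M[R]_(m, d)) (w : 'rV[R]_m) :
  \sum_i w 0 i = 1 -> homogenize (w *m M) = w *m homogenize M.
Proof.
move=> w1; rewrite mul_homogenize w1; congr row_mx.
by apply/rowP => j; rewrite ord1 !mxE.
Qed.

Lemma row_homogenize m (M : 'M[R]_(m, d)) i :
  row i (homogenize M) = homogenize (row i M).
Proof. by rewrite row_row_mx row_const. Qed.

Lemma aff_independent_row_free m (M : 'M[R]_(m, d)) :
  aff_independent M -> row_free (homogenize M).
Proof.
move=> indM; apply/inj_row_free => w; rewrite mul_homogenize.
move=> H; have := etrans H (esym (@row_mx0 R 1 1 d)).
move=> /eq_row_mx[/rowP/(_ 0) + wM]; rewrite !mxE mulr1n => w0.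
exact: indM.
Qed.

Lemma aff_hull_homogenize S n (B : 'M[R]_(n, 1 + d)) x :
  (forall y, S y -> (homogenize y <= B)%MS) -> aff_hull S x ->
  (homogenize x <= B)%MS.
Proof.
move=> SB [m [M [w [SM w1 ->]]]]; rewrite homogenize_affine //.
apply/mulmx_sub/row_subP => i; rewrite row_homogenize; exact/SB/SM.
Qed.

Lemma has_dim_leq S k n (B : 'M[R]_(n, 1 + d)) :
  has_dim S k -> (forall y, S y -> (homogenize y <= B)%MS) ->
  (k.+1 <= \rank B)%N.
Proof.
move=> [M [SM /aff_independent_row_free/eqP rM _]] SB.
rewrite -[X in (X <= _)%N]rM; apply/mxrankS/row_subP => i.
by rewrite row_homogenize; apply/SB/SM.
Qed.

Lemma has_dim_uniq S k l : has_dim S k -> has_dim S l -> k = l.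
Proof.
suff le k' l' : has_dim S k' -> has_dim S l' -> (k' <= l')%N.
  by move=> Sk Sl; apply/eqP; rewrite eqn_leq !le.
move=> Sk [M [_ _ SM]]; rewrite -ltnS.
apply: leq_trans (rank_leq_row (homogenize M)).
apply: has_dim_leq Sk _ => y /SM; apply: aff_hull_homogenize => _ [i ->].
by rewrite -row_homogenize row_sub.
Qed.

Lemma interior_halfspaces m (M : 'M[R]_(m, d)) :
  interior [set x | forall i, dot (row i M) x <= 1] 0.
Proof.
suff : forall i, \forall x \near (0 : 'rV[R]_d), dot (row i M) x <= 1.
  exact: (filter_forall (nbhs_filter (0 : 'rV[R]_d))).
move=> i.
have : \forall x \near (0 : 'rV[R]_d), dot (row i M) x < 1; last first.
  by apply: filterS => x /ltW.
apply: (cvgr_lt _ (@dot_continuous (row i M) 0)).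
by rewrite /dot big1 // => j _; rewrite !mxE mulr0.
Qed.

(** With both row sums zero, the first equation yields [u_i . v_j = 1] for [j != i] and
    [u_i . v_i = - d]. This form is symmetric in [V] and [U] up to transposition, and it is checked
    by sums over the vertices. *)
Definition dual_simplices (V U : 'M[R]_(d.+1, d)) : Prop :=
  [/\ U^T *m V = (- d.+1%:R)%:M, const_mx 1 *m V = 0 :> 'rV_d
    & const_mx 1 *m U = 0 :> 'rV_d].

Lemma dual_simplicesC V U : dual_simplices V U -> dual_simplices U V.
Proof.
case=> UV V0 U0; split=> //.
by rewrite -[LHS]trmxK trmx_mul trmxK UV tr_scalar_mx.
Qed.

(* The homogenizations of [V] and [U] are square and inverse to each other up
   to sign and the factor [d.+1], so their product can be taken in either
   order. *)
Lemma dual_simplices_mul V U : dual_simplices V U ->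
  V *m U^T = const_mx 1 - d.+1%:R%:M.
Proof.
case=> UV V0 U0.
have n0 : d.+1%:R != 0 :> R by rewrite pnatr_eq0.
pose A : 'M[R]_d.+1 := col_mx (const_mx 1 : 'rV_d.+1) U^T.
pose B : 'M[R]_d.+1 := row_mx (- const_mx 1 : 'cV_d.+1) V.
have AB : A *m B = (- d.+1%:R)%:M.
  rewrite [LHS](@mul_col_row R 1 d d.+1 1 d) V0 UV.
  rewrite [RHS](@scalar_mx_block R 1 d); congr (@block_mx R 1 d 1 d _ _ _ _).
    apply/matrixP => i j; rewrite !ord1 !mxE.
    under eq_bigr do rewrite !mxE mul1r.
    by rewrite sumrN sumr_const card_ord mulr1n.
  apply/trmx_inj; rewrite trmx_mul trmxK trmx0 linearN /= mulNmx.
  by rewrite trmx_const U0 oppr0.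
have /mulmx1C : (- d.+1%:R^-1 *: A) *m B = 1%:M.
  by rewrite -scalemxAl AB scale_scalar_mx mulrNN mulVf.
rewrite -scalemxAr => /(congr1 (fun M => - d.+1%:R *: M)).
rewrite scalerA mulrNN divff // scale1r scale_scalar_mx mulr1.
rewrite [LHS](@mul_row_col R d.+1 1 d d.+1) mulNmx => /(canRL (addKr _)).
rewrite opprK => ->; rewrite raddfN; congr (_ - _).
by apply/matrixP => i j; rewrite !mxE big_ord1 !mxE mulr1.
Qed.

(** * Inequalities, vertices and facets of a simplex read off from its dual *)

Section DualSimplices.
Variables V U : 'M[R]_(d.+1, d).
Hypothesis VU : dual_simplices V U.

Let n_neq0 : d.+1%:R != 0 :> R. Proof. by rewrite pnatr_eq0. Qed.

Lemma dot_dual_affine (w : 'rV[R]_d.+1) i : \sum_j w 0 j = 1 ->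
  dot (row i U) (w *m V) = 1 - d.+1%:R * w 0 i.
Proof.
move=> w1; rewrite dot_row -mulmxA dual_simplices_mul // mulmxBr mul_mx_scalar.
rewrite !mxE; congr (_ - _); rewrite -[RHS]w1.
by apply: eq_bigr => j _; rewrite mxE mulr1.
Qed.

(** The weights sum to 1 because the normals sum to 0; they reproduce [x] because [V] has zero row
    sum and [U^T *m V] is scalar. *)
Lemma dual_barycentric x : exists w : 'rV[R]_d.+1,
  [/\ \sum_i w 0 i = 1, x = w *m V
    & forall i, w 0 i = (1 - dot (row i U) x) / d.+1%:R].
Proof.
have [UV V0 U0] := VU.
exists (d.+1%:R^-1 *: (const_mx 1 - x *m U^T)); split.
- under eq_bigr => i _ do rewrite mxE [X in _ * X]mxE [X in _ * (X + _)]mxE.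
  rewrite -mulr_sumr big_split /= sumr_const card_ord -[1 *+ _]/(d.+1%:R).
  suff -> : \sum_i (- (x *m U^T)) 0 i = 0 by rewrite addr0 mulVf.
  transitivity ((- (x *m ((const_mx 1 : 'rV_d.+1) *m U)^T)) 0 0).
    rewrite trmx_mul mulmxA !mxE -sumrN; apply: eq_bigr => i _.
    by rewrite !mxE mulr1.
  by rewrite U0 trmx0 mulmx0 oppr0 mxE.
- rewrite -scalemxAl mulmxBl V0 sub0r -mulmxA UV mul_mx_scalar scaleNr opprK.
  by rewrite scalerA mulVf // scale1r.
- by move=> i; rewrite dot_row !mxE mulrC.
Qed.

Lemma row_conv_dual : row_conv V = [set x | forall i, dot (row i U) x <= 1].
Proof.
apply/seteqP; split=> x /=.
  move=> [w [w0 w1 ->]] i; rewrite dot_dual_affine // gerBl.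
  by rewrite mulr_ge0 ?ler0n.
move=> Ux; have [w [w1 xw wE]] := dual_barycentric x.
exists w; split=> // i.
by rewrite wE divr_ge0 ?ler0n // subr_ge0.
Qed.

Lemma aff_independent_dual : aff_independent V.
Proof.
move=> w w0 wV; apply/rowP => i; rewrite mxE.
have : (w *m V *m U^T) 0 i = 0 by rewrite wV mul0mx mxE.
rewrite -mulmxA dual_simplices_mul // mulmxBr mul_mx_scalar !mxE.
under eq_bigr do rewrite mxE mulr1.
rewrite w0 sub0r => /eqP; rewrite oppr_eq0 mulf_eq0 (negPf n_neq0) /=.
by move/eqP.
Qed.

Lemma has_dim_dual : has_dim (row_conv V) d.
Proof.
exists V; split; [exact: row_conv_row | exact: aff_independent_dual|].
by move=> x [w [_ w1 xw]]; exists d.+1, V, w; split=> // i; exists i.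
Qed.

Lemma polar_row_conv_dual : polar_dual (row_conv U) = row_conv V.
Proof. by rewrite polar_dual_row_conv row_conv_dual. Qed.

Lemma interior_dual : interior (row_conv V) 0.
Proof. by rewrite row_conv_dual; apply: interior_halfspaces. Qed.

Lemma barycentric_tight x i :
  (forall j, j != i -> dot (row j U) x = 1) -> x = row i V.
Proof.
move=> tight; have [w [w1 xw wE]] := dual_barycentric x.
have w0 j : j != i -> w 0 j = 0 by move=> ji; rewrite wE tight // subrr mul0r.
rewrite xw rowE; congr (_ *m _); apply/rowP => j; rewrite mxE /=.
have [->|/w0 //] := eqVneq j i.
by rewrite -w1 (bigD1 i) //= big1 ?addr0.
Qed.

Lemma dot_dual_row i j : i != j -> dot (row j U) (row i V) = 1.
Proof.
move=> ij; rewrite (rowE i V) dot_dual_affine ?sum_delta_row //.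
by rewrite mxE /= eq_sym (negPf ij) mulr0 subr0.
Qed.

(** The lattice generators [M] need not be the rows of [V] a priori. A generator of nonzero weight
    in [v_i] is tight on every facet through [v_i], and only [v_i] itself is. *)
Lemma lattice_polytope_dual :
  lattice_polytope (row_conv V) -> forall i, lattice_point (row i V).
Proof.
move=> [m [M [latM eVM]]] i.
have [w [w0 w1 iw]] : row_conv M (row i V).
  by rewrite -eVM; apply: row_conv_row.
have [k wk] := sum1_neq0 w1.
rewrite -(@barycentric_tight (row k M) i) // => j ji.
apply: conv_tight w0 w1 _ _ k wk.
  move=> l; have : row_conv V (row l M) by rewrite eVM; apply: row_conv_row.
  by rewrite row_conv_dual; apply.
by rewrite -iw dot_dual_row // eq_sym.
Qed.

(** A facet contains at least [d] of the [d.+1] vertices by rank, and not all of them by dimension;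
    the one left out, [i0], names the normal. *)
Lemma facet_dual F : is_facet (row_conv V) F ->
  exists i, aff_hull F = [set x | dot (row i U) x = 1].
Proof.
move=> [[u [c [le_c eF]]] [k [dimP dimF]]].
have dk := has_dim_uniq has_dim_dual dimP.
pose I := [set i | dot u (row i V) == c]%SET.
have le_row i : dot u (row i V) <= c by apply/le_c/row_conv_row.
(* Points of [F] have barycentric coordinates supported on the vertices that lie on the supporting
   hyperplane. *)
have FI x : F x -> exists w : 'rV[R]_d.+1,
    [/\ \sum_i w 0 i = 1, x = w *m V & forall i, i \notin I -> w 0 i = 0].
  rewrite eF => -[[w [w0 w1 xw]] uxc]; exists w; split=> // i.
  rewrite inE; apply: contraNeq => wi.
  by apply/eqP; apply: (conv_tight w0 w1 le_row _ wi); rewrite -xw.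
have IF i : i \in I -> F (row i V).
  by rewrite inE eF => /eqP ?; split=> //; apply: row_conv_row.
(* The homogenized points of [F] lie in the span of [#|I|] rows, while [F] has dimension
   [k = d - 1]. *)
have cardI : (d <= #|I|)%N.
  pose B : 'M[R]_(#|I|, d) := \matrix_(i < #|I|) row (enum_val i) V.
  rewrite [X in (X <= _)%N]dk; apply: leq_trans (rank_leq_row (homogenize B)).
  apply: has_dim_leq dimF _ => x /FI [w [w1 -> w0]].
  rewrite homogenize_affine // mulmx_sum_row.
  apply: summx_sub => i _; have [iI|/w0 ->] := boolP (i \in I).
    apply: scalemx_sub; apply: (eq_row_sub (enum_rank_in iI i)).
    by rewrite !row_homogenize rowK enum_rankK_in.
  by rewrite scale0r sub0mx.
have [i0 i0I] : exists i, i \notin I.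
  apply/existsP; rewrite -negb_forall; apply/negP => /forallP allI.
  have FP : F = row_conv V.
    rewrite eF; apply/seteqP; split=> x [] // w [w0 w1 xw]; split.
      by exists w.
    rewrite xw dot_mulmx -[RHS]mul1r -w1 mulr_suml; apply: eq_bigr => i _.
    by have := allI i; rewrite inE => /eqP ->.
  by rewrite FP in dimF; have := has_dim_uniq dimP dimF; lia.
have inI i : i != i0 -> i \in I.
  apply: contraNT => iI.
  have : (#|~: I|%SET <= 1)%N.
    by have := cardsC I; rewrite card_ord => e; lia.
  by move/card_le1_eqP => eq1; apply/eqP/eq1; rewrite finset.in_setC.
exists i0; apply/seteqP; split=> x /=.
  move=> [m [M [w [FM w1 ->]]]]; rewrite dot_mulmx -w1.
  apply: eq_bigr => i _; have [w' [w'1 -> w'0]] := FI _ (FM i).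
  by rewrite dot_dual_affine // w'0 // mulr0 subr0 mulr1.
move=> xi0; have [w [w1 xw wE]] := dual_barycentric x.
have wi0 : w 0 i0 = 0 by rewrite wE xi0 subrr mul0r.
have [i1 i1I] : exists i, i \in I.
  by apply/card_gt0P; rewrite (leq_trans _ cardI) // dk.
(* Every point listed must lie in [F], so [v_i0] is replaced by a vertex of [F]; its weight is 0, so
   the combination is unchanged. *)
exists d.+1, (\matrix_i row (if i == i0 then i1 else i) V), w; split=> //.
  by move=> i; rewrite rowK; apply: IF; case: eqP => // /eqP/inI.
rewrite xw !mulmx_sum_row; apply: eq_bigr => i _; rewrite rowK.
by case: eqP => // ->; rewrite wi0 !scale0r.
Qed.

End DualSimplices.

End Convexity.

(** * The facet normals for the cycle on [d.+1] vertices *)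

Section Cycle.
Variables (R : realType) (d : nat).

Lemma val_ordS (i : 'I_d.+1) :
  ordS i = (if i == d :> nat then 0 else i.+1)%N :> nat.
Proof.
rewrite /=; have := ltn_ord i.
case: eqP => [->|id lt_id]; first by rewrite modnn.
by rewrite modn_small; lia.
Qed.

Lemma val_ord_pred (i : 'I_d.+1) :
  ord_pred i = (if i == 0%N :> nat then d else i.-1)%N :> nat.
Proof.
rewrite /=; have := ltn_ord i; case: (nat_of_ord i) => [|j] lt_jd.
  by rewrite modn_small.
by rewrite addSn /= modnDr modn_small; lia.
Qed.

(** Adding [d.+1] first keeps the truncated subtraction exact. The shift [d / 2] is the mean of the
    residues, so the rows sum to 0. *)
Definition cycle_dual : 'M[R]_(d.+1, d) :=
  \matrix_(i, b) (((b + d.+1 - i) %% d.+1)%:R - d%:R / 2).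

Lemma cycle_residue (b i : nat) : (b < d.+1)%N -> (i < d.+1)%N ->
  ((b + d.+1 - i) %% d.+1 = if i <= b then b - i else b + d.+1 - i)%N.
Proof.
move=> bd id; case: leqP => ib; last by rewrite modn_small; lia.
by rewrite addnC -addnBA // addnC modnDr modn_small; lia.
Qed.

(** For fixed [b], the map [i -> b - i] modulo [d.+1] is an involution, so the sum is
    [0 + 1 + ... + d]. *)
Lemma sum_cycle_residue (b : 'I_d) :
  \sum_(i < d.+1) ((b + d.+1 - i) %% d.+1)%:R = d.+1%:R * d%:R / 2 :> R.
Proof.
pose h (i : 'I_d.+1) : 'I_d.+1 := inZp (b + d.+1 - i).
have h_inj : injective h.
  apply: (can_inj (g := h)) => i; apply/val_inj; rewrite /=.
  have := ltn_ord i; have := ltn_ord b => bd id.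
  rewrite (@cycle_residue b i) //; last lia.
  by case: leqP => ib; rewrite cycle_residue //; do ?case: ifP; lia.
transitivity (\sum_(i < d.+1) (i : nat)%:R : R); last first.
  elim: d => [|m IHm]; first by rewrite big_ord1 mulr0 mul0r.
  by rewrite big_ord_recr /= IHm -!natr1; field.
by rewrite [RHS](reindex_inj h_inj).
Qed.

Lemma lattice_cycle_dual : ~~ odd d ->
  forall i, lattice_point (row i cycle_dual).
Proof.
move=> evd i b; rewrite !mxE.
rewrite -[in d%:R](even_halfK evd) -mul2n natrM mulrC mulKf.
  by rewrite rpredB ?natr_int.
by rewrite pnatr_eq0.
Qed.

Lemma even_of_lattice_cycle_dual : (0 < d)%N ->
  lattice_point (row 0 cycle_dual) -> ~~ odd d.
Proof.
(* The first entry of row 0 is [- d / 2]. *)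
move=> d_gt0 /(_ (Ordinal d_gt0)).
rewrite !mxE /= add0n subn0 modnn sub0r rpredN => /intrP[m dm].
have : d%:Z = 2 * m.
  by apply: (@intr_inj R); rewrite intrM -dm mulrC divfK ?pnatr_eq0.
by lia.
Qed.

(** The entries are [2 r - d], and each row omits only one residue [r]. So one of the two middle
    residues [d./2] and [d./2.+1] occurs, giving -1 or 1. *)
Lemma primitive_cycle_dual (i : 'I_d.+1) : odd d ->
  primitive (2 *: row i cycle_dual).
Proof.
move=> oddd.
have entry (b : 'I_d) : (2 *: row i cycle_dual) 0 b =
    2 * ((b + d.+1 - i) %% d.+1)%:R - d%:R.
  by rewrite !mxE mulrBr mulrCA divff ?mulr1 ?pnatr_eq0.
have [b bE] : exists b : 'I_d,
    ((b + d.+1 - i) %% d.+1 = d./2 \/ (b + d.+1 - i) %% d.+1 = d./2.+1)%N.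
  have id := ltn_ord i.
  have dE : d = (d./2.*2).+1 by rewrite -[LHS](odd_double_half d) oddd.
  set h := d./2 in dE *.
  (* Column [i + h] has residue [h]; if [i > h], that column may be out of range, and column
     [i - h.+1] has residue [h.+1]. *)
  have cd : ((if i <= h then i + h else i - h.+1) < d)%N by case: ifP; lia.
  exists (Ordinal cd); rewrite /= cycle_residue //; last lia.
  by case: (leqP i h) => ih; case: ifP => ?; lia.
apply: (@primitive_unit_entry _ _ _ b) => [c|].
  by rewrite entry rpredB // ?rpredM // ?natr_int.
have dE : d%:R = 2 * (d./2)%:R + 1 :> R.
  by rewrite -{1}(odd_double_half d) oddd add1n -natr1 -mul2n natrM.
rewrite entry dE.
case: bE => ->.
  by rewrite [X in `|X|](_ : _ = -1) ?normrN1 //; ring.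
by rewrite -natr1 [X in `|X|](_ : _ = 1) ?normr1 //; ring.
Qed.

(** * The Laplacian simplex of the cycle *)

Hypothesis d_gt1 : (1 < d)%N.

Let G := cycle_graph d.+1.

Lemma cycle_adjE (i j : 'I_d.+1) :
  adj G i j = (j == ordS i) || (j == ord_pred i).
Proof.
rewrite /= /cycle_adj -!(inj_eq (@ord_inj _)) !val_ordS val_ord_pred.
have := ltn_ord i; have := ltn_ord j.
by do !case: ifP; lia.
Qed.

Lemma cycle_degree (i : 'I_d.+1) : degree G i = 2%N.
Proof.
rewrite /degree (_ : [set _ | _]%SET = [set ordS i; ord_pred i]%SET).
  rewrite cards2 -(inj_eq (@ord_inj _)) val_ordS val_ord_pred.
  by have := ltn_ord i; do !case: ifP; lia.
by apply/finset.setP => k; rewrite !inE cycle_adjE.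
Qed.

Lemma cycle_laplacianE (i j : 'I_d.+1) : laplacian G i j =
  2 * (j == i)%:Z - (j == ordS i)%:Z - (j == ord_pred i)%:Z.
Proof.
rewrite mxE cycle_degree cycle_adjE.
rewrite -!(inj_eq (@ord_inj _)) val_ordS val_ord_pred.
have := ltn_ord i; have := ltn_ord j.
by do !case: ifP; lia.
Qed.

(** Column [a] sums the Laplacian entries over [j <= a], so each indicator of a column [k] becomes
    [k <= a]. The last two terms come from the wrap-around at rows 0 and [d]. *)
Lemma cycle_laplacianBE (i : 'I_d.+1) (a : 'I_d) : laplacianB G i a =
  (i == a :> nat)%:Z - (i == a.+1 :> nat)%:Z
    + (i == 0%N :> nat)%:Z - (i == d :> nat)%:Z.
Proof.
rewrite mxE; under eq_bigr do rewrite cycle_laplacianE mxE !mulrBl -mulrA.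
have sum1 (k : 'I_d.+1) : \sum_j (j == k)%:Z * (j <= a)%N%:Z = (k <= a)%N%:Z.
  rewrite (bigD1 k) //= eqxx mul1r big1 ?addr0 // => j /negPf ->.
  by rewrite mul0r.
rewrite !sumrB -mulr_sumr !sum1 val_ordS val_ord_pred.
have := ltn_ord i; have := ltn_ord a.
by do !case: ifP; lia.
Qed.

Lemma cycle_dual_simplices :
  dual_simplices (map_mx intr (laplacianB G)) cycle_dual.
Proof.
have vE i a : map_mx intr (laplacianB G) i a = (i == a :> nat)%:R -
    (i == a.+1 :> nat)%:R + (i == 0%N :> nat)%:R - (i == d :> nat)%:R :> R.
  by rewrite mxE cycle_laplacianBE !(rmorphD, rmorphN).
have sumE (f : nat -> R) k : (k < d.+1)%N ->
    \sum_(i < d.+1) f i * (i == k :> nat)%:R = f k.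
  move=> kd; rewrite (bigD1 (Ordinal kd)) //= eqxx mulr1 big1 ?addr0 // => i.
  by rewrite -(inj_eq (@ord_inj _)) /= => /negPf ->; rewrite mulr0.
have sumV (f : nat -> R) (a : 'I_d) :
    \sum_(i < d.+1) f i * map_mx intr (laplacianB G) i a =
    f a - f a.+1 + f 0%N - f d.
  under eq_bigr do rewrite vE !mulrDr !mulrN.
  rewrite !(sumrB, big_split) /= !sumE //; have := ltn_ord a; lia.
split.
- apply/matrixP => b a; rewrite !mxE.
  pose f k : R := ((b + d.+1 - k) %% d.+1)%:R - d%:R / 2.
  under eq_bigr do rewrite mxE [cycle_dual _ _]mxE -/(f _).
  rewrite sumV /f -val_eqE /=.
  (* Passing from [a] to [a.+1] lowers the residue of [b - a] by 1, except at [a = b], where it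
     jumps from 0 to [d]. The wrap-around terms [b] and [b.+1] absorb the 1, leaving [- d.+1] on the
     diagonal. *)
  have /(congr1 (fun m => m%:R : R)) :
     ((b + d.+1 - a) %% d.+1 + (b + d.+1 - 0) %% d.+1 + d.+1 * (b == a :> nat) =
      (b + d.+1 - a.+1) %% d.+1 + (b + d.+1 - d) %% d.+1)%N.
    have := ltn_ord a; have := ltn_ord b => bd ad.
    rewrite !cycle_residue ?leq0n //; try lia.
    by case: (b == a :> nat) / eqP => ba; rewrite ?muln1 ?muln0;
      do !case: ifP; lia.
  rewrite !natrD natrM mulr_natr mulNrn; lra.
- apply/rowP => a; rewrite !mxE.
  under eq_bigr do rewrite [const_mx _ _ _]mxE.
  by rewrite (sumV (fun=> 1)); ring.
- apply/rowP => b; rewrite !mxE.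
  under eq_bigr do rewrite !mxE mul1r.
  rewrite sumrB sum_cycle_residue sumr_const card_ord.
  by rewrite mulr_natl mulrnAl subrr.
Qed.

Lemma cycle_row_lattice i :
  lattice_point (row i (map_mx intr (laplacianB G) : 'M[R]_(d.+1, d))).
Proof. by move=> j; rewrite !mxE intr_int. Qed.

Lemma cycle_row_primitive i :
  primitive (row i (map_mx intr (laplacianB G) : 'M[R]_(d.+1, d))).
Proof.
have [j j1] : exists j : 'I_d, `|laplacianB G i j| = 1.
  have [id d0] : (i <= d)%N /\ (0 < d)%N by have := ltn_ord i; lia.
  (* Column 0 of row 0 holds 2, so column 1 serves there and needs [1 < d]; row [d] has -1 in column
     0, and any other row [i] has 1 in column [i]. *)
  have cd : ((if i == 0%N :> nat then 1
              else if i == d :> nat then 0 else i) < d)%N.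
    by do !case: ifP; lia.
  exists (Ordinal cd); rewrite cycle_laplacianBE /=.
  by do !case: ifP; lia.
apply: (@primitive_unit_entry _ _ _ j); first exact: cycle_row_lattice.
by rewrite 2!mxE -intr_norm j1.
Qed.

Lemma cycle_lattice_polytope : lattice_polytope (laplacian_simplex G R).
Proof.
exists d.+1, (map_mx intr (laplacianB G)); split=> // i.
exact: cycle_row_lattice.
Qed.

(** The polar is the hull of the rows of [cycle_dual], a lattice polytope exactly when these rows
    are integral. Here [n = d.+1], so even [d] means odd [n]. *)
Lemma cycle_reflexive : reflexive_polytope (laplacian_simplex G R) <-> ~~ odd d.
Proof.
have D := cycle_dual_simplices; have D' := dual_simplicesC D.
rewrite /reflexive_polytope /laplacian_simplex (polar_row_conv_dual D').
split=> [[_ _ _ /(lattice_polytope_dual D') lat]|evd].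
  by apply: even_of_lattice_cycle_dual (lat 0); exact: ltnW.
split; [exact: cycle_lattice_polytope | exact: has_dim_dual D
       | exact: interior_dual D |].
by exists d.+1, cycle_dual; split=> // i; exact: lattice_cycle_dual.
Qed.

Lemma cycle_2reflexive : odd d -> ell_reflexive 2 (laplacian_simplex G R).
Proof.
move=> oddd; have D := cycle_dual_simplices.
split; [split=> //; exact: cycle_lattice_polytope | exact: interior_dual D | |].
  by move=> v /vertex_row_conv [i ->]; exact: cycle_row_primitive.
move=> F /(facet_dual D) [i ->].
(* Doubling [u_i . x = 1] gives an equation with a primitive integral normal and right-hand side
   2. *)
exists (2 *: row i cycle_dual); first exact: primitive_cycle_dual.
apply/seteqP; split=> x /=; rewrite dotZl.
  by move=> ->; rewrite mulr1.
by rewrite -[RHS]mulr1 => /mulfI; apply; rewrite pnatr_eq0.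
Qed.

End Cycle.

Theorem theorem5p1 (R : realType) :
  (forall n : nat, (3 <= n)%N ->
     (reflexive_polytope (laplacian_simplex (cycle_graph n) R) <-> odd n)) /\
  (forall k : nat, (2 <= k)%N ->
     ell_reflexive 2 (laplacian_simplex (cycle_graph (2 * k)) R)).
Proof.
split=> [[//|d] d_gt1|k k_gt1]; first exact: cycle_reflexive.
have [] : (3 <= 2 * k)%N /\ ~~ odd (2 * k) by rewrite oddM; lia.
case: (2 * k)%N => [//|d] d_gt1 oddd.
by apply: cycle_2reflexive => //; rewrite -[odd d]negbK.
Qed.
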